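(* Let $\mathbb P^\star$ be the true distribution on $\mathcal X\times\mathcal Y$, let $\widehat{\mathbb P}_N$ be the empirical distribution formed from $N$ independent and identically distributed observations from $\mathbb P^\star$, and fix $\beta_W,\beta_{\mathcal N}\in[0,1)$ with $\beta_W+\beta_{\mathcal N}<1$. The Borel neighborhood $\mathcal N_N\subseteq\mathcal X$, the radius $\theta_N\ge0$, the minimum probability $\varepsilon_N>0$, and the decision $z_N\in\mathcal Z$ may all depend on the data. Assume that the resulting random quantities and the events below are measurable, that $z_N$ is almost surely feasible for the realized model, i.e. $\sup_{\mathbb P\in\mathcal P_{\theta_N,\varepsilon_N}(\mathcal N_N)}\mathbb P[Y\notin\mathcal S(z_N)\mid X\in\mathcal N_N]\le\epsilon$ almost surely, and that $$(\mathbb P^\star)^N\big[W(\mathbb P^\star,\widehat{\mathbb P}_N)\le\theta_N\big]\ge1-\beta_W,\qquad(\mathbb P^\star)^N\big[\mathbb P^\star_X(\mathcal N_N)\ge\varepsilon_N\big]\ge1-\beta_{\mathcal N}.$$ Then $$(\mathbb P^\star)^N\Big[\mathbb P^\star_X(\mathcal N_N)\ge\varepsilon_N,\ \ \mathbb P^\star\big((X,Y)\in\mathcal N_N\times\mathcal S^c(z_N)\big)\le\epsilon\,\mathbb P_X^\star(\mathcal N_N)\Big]\ge1-\beta_W-\beta_{\mathcal N},$$ that is, with at least this probability the conditional violation probability is well defined and at most $\epsilon$.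
   Context: $(\mathcal X,d_{\mathcal X})$ and $(\mathcal Y,d_{\mathcal Y})$ are Polish metric spaces with their Borel $\sigma$-fields; $X,Y$ denote the coordinates of $\mathcal X\times\mathcal Y$; $\mathbb P_X$ is the $\mathcal X$-marginal of $\mathbb P$. $\mathcal Z\subseteq\mathbb R^{\dim(z)}$ is the decision set; for $z\in\mathcal Z$, $\mathcal S(z)\subseteq\mathcal Y$ is the safety set and $\mathcal S^c(z)=\mathcal Y\setminus\mathcal S(z)$ the failure set, a nonempty Borel set. $\epsilon\in(0,1)$ is the risk limit (distinct from $\varepsilon$). $W$ is the type-1 Wasserstein distance on distributions on $\mathcal X\times\mathcal Y$ with ground metric $d_{\mathcal X}(x,x')+d_{\mathcal Y}(y,y')$. For $\theta\ge0$, $\varepsilon>0$ and Borel $\mathcal N\subseteq\mathcal X$, $$\mathcal P_{\theta,\varepsilon}(\mathcal N)=\{\mathbb P: W(\mathbb P,\widehat{\mathbb P}_N)\le\theta,\ \mathbb P_X(\mathcal N)\ge\varepsilon\}.$$ $(\mathbb P^\star)^N$ is the $N$-fold product law of the data. *)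

(* Defs.v *)
From HB Require Import structures.
From mathcomp Require Import all_boot all_order all_algebra.
From mathcomp Require Import all_classical all_reals all_analysis.

Set Implicit Arguments.
Unset Strict Implicit.
Unset Printing Implicit Defensive.

Import Order.TTheory GRing.Theory Num.Theory.
Import numFieldTopology.Exports numFieldNormedType.Exports.

Local Open Scope classical_set_scope.
Local Open Scope ring_scope.
Local Open Scope ereal_scope.

HB.mixin Record isSeparable T & Topological T := {
  separable_space : exists2 D : set T, countable D & dense D }.

(* [Complete] is phrased with Cauchy filters for the uniformity of the metric.
   It makes the type pointed, which loses nothing for spaces that carry a
   probability. *)
#[short(type="polishMetricType")]
HB.structure Definition PolishMetric (R : numDomainType) :=
  {T of Metric R T & Complete T & isSeparable T}.

Notation borel T := (g_sigma_algebraType (@open T)).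

Section iid_law.
Context d (T : measurableType d) (R : realType).

Definition cons_pair n (u : T * n.-tuple T) : n.+1.-tuple T :=
  [the n.+1.-tuple T of u.1 :: u.2].

Let measurable_cons_pair n : measurable_fun [set: T * n.-tuple T] (@cons_pair n).
Proof. exact: measurable_cons. Qed.

HB.instance Definition _ n :=
  isMeasurableFun.Build _ _ _ _ (@cons_pair n) (@measurable_cons_pair n).

Fixpoint iid_law (P : probability T R) n : probability (n.-tuple T) R :=
  if n is m.+1 then distribution (P \x iid_law P m) (@cons_pair m)
  else \d_ [tuple].

Lemma iid_lawE (P : probability T R) n (A : 'I_n -> set T) :
  (forall i, measurable (A i)) ->
  iid_law P n [set w | forall i, A i (tnth w i)] = \prod_(i < n) P (A i).
Proof.
elim: n A => [|n IH] A mA.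
  rewrite big_ord0 /= diracE mem_set//=; last by case.
rewrite big_ord_recl /= /distribution /pushforward.
rewrite (_ : _ @^-1` _ =
  A ord0 `*` [set w | forall i, A (lift ord0 i) (tnth w i)]).
  rewrite product_measure1E//; last first.
    rewrite (_ : [set w | _] =
      \bigcap_(i : 'I_n) ((@tnth n T)^~ i @^-1` A (lift ord0 i))).
      apply: fin_bigcap_measurable => [|i _]; last first.
        by rewrite -[X in measurable X]setTI; exact: measurable_tnth.
      rewrite -(_ : [set` {: 'I_n}] = [set: 'I_n]); last by apply/seteqP.
      exact: finite_finset.
    by apply/seteqP; split => [w /= Aw i _|w /= Aw i]; exact: Aw.
  by congr (_ * _); exact: (IH (fun i => A (lift ord0 i))).
apply/seteqP; split => [[x w]/= Aw|[x w]/= [Ax Aw] i].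
  split; first by have := Aw ord0; rewrite tnth0.
  by move=> i; have := Aw (lift ord0 i); rewrite tnthS.
by case: (unliftP ord0 i) => [j|] ->; rewrite ?tnthS ?tnth0.
Qed.

End iid_law.

Section empirical.
Context d (T : measurableType d) (R : realType).

Let invn_ge0 n : (0 <= n%:R^-1 :> R)%R. Proof. by rewrite invr_ge0. Qed.

Definition empirical n (w : n.-tuple T) : {measure set T -> \bar R} :=
  mscale (NngNum (invn_ge0 n)) (msum (fun i => \d_ (nth point w i)) n).

Lemma empirical_setT n (w : n.-tuple T) : (0 < n)%N -> empirical w setT = 1.
Proof.
move=> n0; rewrite /empirical /= /mscale /= /msum.
rewrite (eq_bigr (fun=> 1 : \bar R)); last by move=> i _; exact: diracT.
by rewrite sumEFin -EFinM sumr_const card_ord mulVf// pnatr_eq0 -lt0n.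
Qed.

End empirical.

Section wasserstein.
Context d (T : measurableType d) (R : realType).
Implicit Types P Q : {measure set T -> \bar R}.

Definition coupling P Q : set (probability (T * T)%type R) :=
  [set pi | forall A, measurable A ->
     pushforward pi fst A = P A /\ pushforward pi snd A = Q A].

Definition wasserstein1 (c : T -> T -> R) P Q : \bar R :=
  ereal_inf [set \int[pi]_u (c u.1 u.2)%:E | pi in coupling P Q].

(* With the library conventions for [0^-1], this is 0 when [P B = 0]. *)
Definition cond_prob P (A B : set T) : \bar R := P (A `&` B) / P B.

End wasserstein.

(* As both factors are separable, the product sigma-algebra carried by this
   type is the Borel sigma-algebra of the product topology. *)
Notation data X Y := (borel X * borel Y)%type.

Section model.
Context (R : realType) (X Y : polishMetricType R).

Definition sum_dist (u v : data X Y) : R :=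
  mdist (u.1 : X) (v.1 : X) + mdist (u.2 : Y) (v.2 : Y).

Definition marginalX (P : {measure set (data X Y) -> \bar R}) : set X -> \bar R :=
  pushforward P fst.

Definition ambiguity n (w : n.-tuple (data X Y)) (theta eps : R) (N : set X) :
    set (probability (data X Y) R) :=
  [set P | wasserstein1 sum_dist P (empirical R w) <= theta%:E /\
           eps%:E <= marginalX P N].

Definition worst_case_violation n (w : n.-tuple (data X Y)) (theta eps : R)
    (N : set X) (Sz : set Y) : \bar R :=
  ereal_sup [set cond_prob P [set u | ~ Sz u.2] [set u | N u.1]
            | P in ambiguity w theta eps N].

End model.

(* Main.v *)
Require Import Defs.
From mathcomp Require Import all_boot all_order all_algebra.
From mathcomp Require Import all_classical all_reals all_analysis.
From mathcomp Require Import lra.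

(** The guarantee is deterministic on the intersection of two events. If the
    true law lies within the Wasserstein radius of the empirical law and gives
    the neighborhood at least the prescribed mass, then it is itself a member
    of the ambiguity set, so feasibility of the decision for the worst case
    transfers to it ([ambiguity_violation_le]). Feasibility holds only almost
    surely, hence the intersection of the two events is included in the target
    event up to a null set ([le_measure_ae]); its probability is at least
    [1 - betaW - betaN] by inclusion-exclusion
    ([probability_setI_ge]). *)

Set Implicit Arguments.
Unset Strict Implicit.
Unset Printing Implicit Defensive.

Import Order.TTheory GRing.Theory Num.Theory.
Import numFieldTopology.Exports numFieldNormedType.Exports.

Local Open Scope classical_set_scope.
Local Open Scope ring_scope.
Local Open Scope ereal_scope.

(** Any member of the ambiguity set is a competitor in the supremum, so a bound
    on the worst case bounds its conditional violation probability; multiplying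
    by the conditioning mass is legitimate because that mass is at least
    [eps], hence positive, and finite. *)
Lemma ambiguity_violation_le (R : realType) (X Y : polishMetricType R) (n : nat)
    (w : n.-tuple (data X Y)) (theta eps : R) (B : set X) (Sz : set Y) (r : R)
    (P : probability (data X Y) R) :
  measurable (B : set (borel X)) -> (0 < eps)%R ->
  worst_case_violation w theta eps B Sz <= r%:E ->
  ambiguity w theta eps B P ->
  P (B `*` ~` Sz) <= r%:E * marginalX P B.
Proof.
move=> mB eps0 wc_le ambP.
have PB_gt0 : 0 < marginalX P B.
  by case: ambP => _; apply: lt_le_trans; rewrite lte_fin.
have PB_fin : marginalX P B \is a fin_num.
  apply: fin_num_measure.
  by rewrite -[X in measurable X]setTI; exact: measurable_fst.
have : P ([set u | ~ Sz u.2] `&` [set u | B u.1]) / marginalX P B <= r%:E.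
  by apply: le_trans wc_le; apply: ereal_sup_ubound; exists P.
have -> : B `*` ~` Sz = [set u | ~ Sz u.2] `&` [set u | B u.1].
  by rewrite setIC.
move: PB_gt0; rewrite -(fineK PB_fin) lte_fin => PB_gt0.
by rewrite inver gt_eqF// lee_pdivrMr.
Qed.

(** Inclusion-exclusion: the union has mass at most one, so the two events can
    miss at most [a + b] of the mass jointly. *)
Lemma probability_setI_ge d (T : measurableType d) (R : realType)
    (P : probability T R) (A B : set T) (a b : R) :
  measurable A -> measurable B ->
  (1 - a)%:E <= P A -> (1 - b)%:E <= P B -> (1 - a - b)%:E <= P (A `&` B).
Proof.
move=> mA mB.
have PB_lty : P B < +oo.
  by apply: le_lt_trans (probability_le1 P mB) _; rewrite ltry.
have : P A + P B - P (A `&` B) <= 1.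
  have := probability_le1 P (measurableU _ _ mA mB).
  by rewrite measureUfinr.
rewrite -(fineK (fin_num_measure P _ mA)) -(fineK (fin_num_measure P _ mB)).
rewrite -(fineK (fin_num_measure P _ (measurableI _ _ mA mB))).
rewrite !(lee_fin, =^~ EFinD, =^~ EFinN); lra.
Qed.

Lemma le_measure_ae d (T : measurableType d) (R : realType)
    (mu : {measure set T -> \bar R}) (A B : set T) :
  measurable A -> measurable B ->
  {ae mu, forall x, A x -> B x} -> mu A <= mu B.
Proof.
move=> mA mB [F [mF F0 AB]].
have AsubBF : A `<=` B `|` F.
  move=> x Ax; have [Bx|nBx] := pselect (B x); first by left.
  by right; apply: AB => /(_ Ax).
rewrite -(measureU0 mB mF F0); apply: le_measure => //; rewrite inE//.
exact: measurableU.
Qed.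

Theorem theorem5 (R : realType) (X Y : polishMetricType R)
    (dimz : nat) (Z : set 'rV[R]_dimz) (S : 'rV[R]_dimz -> set Y)
    (risk : R) (Pstar : probability (data X Y) R) (N : nat)
    (betaW betaN : R)
    (nbhd : N.-tuple (data X Y) -> set X)
    (theta eps : N.-tuple (data X Y) -> R)
    (z : N.-tuple (data X Y) -> 'rV[R]_dimz) :
  (* the failure sets are nonempty and Borel *)
  (forall zeta, Z zeta ->
     ~` S zeta !=set0 /\ measurable (~` S zeta : set (borel Y))) ->
  (0 < risk < 1)%R ->
  (0 < N)%N ->
  (0 <= betaW < 1)%R -> (0 <= betaN < 1)%R -> (betaW + betaN < 1)%R ->
  (* data-dependent neighborhood, radius, minimum probability, decision *)
  (forall w, measurable (nbhd w : set (borel X))) ->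
  (forall w, (0 <= theta w)%R) ->
  (forall w, (0 < eps w)%R) ->
  (forall w, Z (z w)) ->
  (* measurability of the random quantities and of the events *)
  measurable_fun setT theta ->
  measurable_fun setT eps ->
  measurable_fun setT (z : _ -> borel 'rV[R]_dimz) ->
  measurable [set w : N.-tuple (data X Y) |
    wasserstein1 (@sum_dist R X Y) Pstar (empirical R w) <= (theta w)%:E] ->
  measurable [set w | (eps w)%:E <= marginalX Pstar (nbhd w)] ->
  measurable [set w | (eps w)%:E <= marginalX Pstar (nbhd w) /\
    Pstar (nbhd w `*` ~` S (z w)) <= risk%:E * marginalX Pstar (nbhd w)] ->
  (* feasibility for the realized model *)
  {ae iid_law Pstar N, forall w,
    worst_case_violation w (theta w) (eps w) (nbhd w) (S (z w)) <= risk%:E} ->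
  (1 - betaW)%:E <= iid_law Pstar N [set w |
    wasserstein1 (@sum_dist R X Y) Pstar (empirical R w) <= (theta w)%:E] ->
  (1 - betaN)%:E <= iid_law Pstar N [set w |
    (eps w)%:E <= marginalX Pstar (nbhd w)] ->
  (1 - betaW - betaN)%:E <= iid_law Pstar N [set w |
    (eps w)%:E <= marginalX Pstar (nbhd w) /\
    Pstar (nbhd w `*` ~` S (z w)) <= risk%:E * marginalX Pstar (nbhd w)].
Proof.
move=> _ _ _ _ _ _ mnbhd _ eps_gt0 _ _ _ _ mW mN mC feas PW PN.
apply: le_trans (probability_setI_ge mW mN PW PN) _.
apply: le_measure_ae => //; first exact: measurableI.
apply: filterS feas => w wc_le [Ww Nw]; split => //.
exact: ambiguity_violation_le wc_le _.
Qed.
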